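(* Let $f_1,\ldots,f_m:\mathbb{R}^n\to\mathbb{R}^n$ be continuous maps with $f_i(0)=0$ for all $i$, and consider the nonlinear switched system $$x_{k+1}\in \mathrm{conv}\{f_1(x_k),\ldots,f_m(x_k)\}.$$ If there exist $K$ convex functions $V_1,\ldots,V_K:\mathbb{R}^n\to\mathbb{R}$ that satisfy $V_i(0)=0$ and $V_i(x)>0$ for all $x\neq0$, for all $i\in\{1,\ldots,K\}$, and such that $$\forall (i,j)\in\{1,\ldots,m\}\times\{1,\ldots,K\},\ \exists k\in\{1,\ldots,K\}\ \text{such that}\ V_j(f_i(x))<V_k(x)\quad \forall x\neq0,$$ then the origin is globally asymptotically stable under arbitrary switching. Moreover, if these constraints are satisfied, then the convex function $$W(x):=\max\{V_1(x),\ldots,V_K(x)\}$$ is a common Lyapunov function for $f_1,\ldots,f_m$; that is, $W(0)=0$, $W(x)>0$ for all $x\ne0$, and $W(f_i(x))<W(x)$ for all $x\neq 0$ and all $i\in\{1,\ldots,m\}$.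
   Context: $\mathrm{conv}$ denotes the convex hull. A trajectory of the switched system is any sequence $(x_k)_{k\ge0}$ in $\mathbb{R}^n$ with $x_{k+1}\in \mathrm{conv}\{f_1(x_k),\ldots,f_m(x_k)\}$ for all $k$ (the element of the convex hull may be chosen arbitrarily at each step). The origin is globally asymptotically stable under arbitrary switching if it is stable in the sense of Lyapunov (for every $\epsilon>0$ there is $\delta>0$ such that every trajectory with $\|x_0\|\le\delta$ satisfies $\|x_k\|\le\epsilon$ for all $k$) and every trajectory, from any $x_0\in\mathbb{R}^n$, converges to the origin. *)

(* Defs.v *)
From HB Require Import structures.
From mathcomp Require Import all_boot all_order all_algebra.
From mathcomp Require Import all_classical all_reals all_analysis.

Set Implicit Arguments.
Unset Strict Implicit.
Unset Printing Implicit Defensive.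

Import Order.TTheory GRing.Theory Num.Theory.
Import numFieldNormedType.Exports.

Local Open Scope classical_set_scope.
Local Open Scope ring_scope.

Definition convex_hull (R : realType) (E : lmodType R) (A : set E) : set E :=
  smallest (fun B : set E => convex_set (B : set (convex_lmodType E))) A.

(* The library norm on 'rV[R]_n is the sup norm, hence this definition; both
   norms induce the same topology. *)
Definition enorm (R : realType) (n : nat) (x : 'rV[R]_n) : R :=
  Num.sqrt (\sum_(i < n) x 0 i ^+ 2).

Definition trajectory (R : realType) (n m : nat)
    (f : 'I_m -> 'rV[R]_n -> 'rV[R]_n) (x : nat -> 'rV[R]_n) : Prop :=
  forall k : nat, convex_hull (range (fun i : 'I_m => f i (x k))) (x k.+1).

Definition lyapunov_stable (R : realType) (n m : nat)
    (f : 'I_m -> 'rV[R]_n -> 'rV[R]_n) : Prop :=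
  forall e : R, 0 < e -> exists2 d : R, 0 < d &
    forall x : nat -> 'rV[R]_n, trajectory f x -> enorm (x 0%N) <= d ->
      forall k : nat, enorm (x k) <= e.

Definition globally_asymptotically_stable (R : realType) (n m : nat)
    (f : 'I_m -> 'rV[R]_n -> 'rV[R]_n) : Prop :=
  lyapunov_stable f /\
  forall x : nat -> 'rV[R]_n, trajectory f x -> x @ \oo --> (0 : 'rV[R]_n).

Definition positive_definite (R : realType) (n : nat)
    (V : 'rV[R]_n -> R) : Prop :=
  V 0 = 0 /\ forall x : 'rV[R]_n, x <> 0 -> 0 < V x.

Definition common_lyapunov (R : realType) (n m : nat)
    (f : 'I_m -> 'rV[R]_n -> 'rV[R]_n) (W : 'rV[R]_n -> R) : Prop :=
  positive_definite W /\
  forall (i : 'I_m) (x : 'rV[R]_n), x <> 0 -> W (f i x) < W x.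

(* The seed of the iterated maximum is one of the values V k x, so that this is
   exactly their maximum; hK guarantees that there is one. *)
Definition max_fun (R : realType) (n K : nat) (hK : (0 < K)%N)
    (V : 'I_K -> 'rV[R]_n -> R) (x : 'rV[R]_n) : R :=
  \big[Num.max/V (Ordinal hK) x]_(k < K) V k x.

(* Main.v *)
(* Since V_j o f_i is dominated by some V_k for all i and j, W = max_k V_k
   strictly decreases under every f_i.  Being convex, W has convex sublevel sets,
   so the decrease extends to the convex hull of the f_i(x): along a trajectory
   W(x_{k+1}) <= G(x_k), where G(x) = max(0, max_i W(f_i(x))) < W(x) for x <> 0.
   A convex function on R^n is continuous and, when positive definite, grows at
   least linearly at infinity, so its sublevel sets are compact; hence W - G is
   bounded below by a positive constant on {c <= W <= W(x_0)}, and W(x_k) -> 0. *)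
Require Import Defs.
From HB Require Import structures.
From mathcomp Require Import all_boot all_order all_algebra.
From mathcomp Require Import all_classical all_reals all_analysis.
From mathcomp Require Import ring lra.

Set Implicit Arguments.
Unset Strict Implicit.

Import Order.TTheory GRing.Theory Num.Theory.
Import numFieldNormedType.Exports.

Local Open Scope classical_set_scope.
Local Open Scope ring_scope.

(** * Convex functions and convex hulls *)

Lemma convex_functionP (R : realType) (E : lmodType R) (W : E -> R) :
  convex_function setT W <->
  forall (t : R) (x y : E), 0 <= t -> t <= 1 ->
    W (t *: x + (1 - t) *: y) <= t * W x + (1 - t) * W y.
Proof.
split=> [cW t x y t0 t1|cW t x y _ _]; last by apply: cW.
by apply: (cW (Itv01 t0 t1)); rewrite inE.
Qed.

(** The sublevel set [W <= b] is convex and contains [A], so it is one of the sets that the hull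
    intersects. *)
Lemma convex_hull_le (R : realType) (E : lmodType R) (W : E -> R) (A : set E)
    (b : R) :
  convex_function setT W -> (forall x, A x -> W x <= b) ->
  forall x, convex_hull A x -> W x <= b.
Proof.
move=> cW Ab x.
suff cB : convex_set ([set y | W y <= b] : set (convex_lmodType E)).
  by move/(_ [set y | W y <= b]); apply; split=> // y /Ab.
move=> y z t /set_mem /= yb /set_mem /= zb; apply/mem_set => /=.
have t0 : 0 <= t%:num by [].
have t1 : t%:num <= 1 by [].
move/convex_functionP: cW => /(_ t%:num y z t0 t1)/le_trans; apply.
nra.
Qed.

(** * Comparison of the sup norm with the Euclidean norm *)

Section norms.
Variables (R : realType) (n : nat).
Implicit Type x : 'rV[R]_n.

Lemma rV_coord_le_norm x (i : 'I_n) : `|x 0 i| <= `|x|.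
Proof.
rewrite [leRHS]/Num.norm /= mx_normrE.
by apply/bigmax_geP; right => /=; exists (0, i).
Qed.

Lemma norm_le_enorm x : `|x| <= enorm x.
Proof.
rewrite [leLHS]/Num.norm /= mx_normrE; apply/bigmax_leP; split; first exact: sqrtr_ge0.
move=> [i j] _ /=; rewrite (ord1 i) -sqrtr_sqr ler_wsqrtr//.
by rewrite (bigD1 j)//= lerDl sumr_ge0// => k _; exact: sqr_ge0.
Qed.

Lemma enorm_le_norm x : enorm x <= n.+1%:R * `|x|.
Proof.
have nx0 : 0 <= n.+1%:R * `|x| by rewrite mulr_ge0.
rewrite -[leRHS](ger0_norm nx0) -sqrtr_sqr ler_wsqrtr//.
have -> : (n.+1%:R * `|x|) ^+ 2 = n.+1%:R * (n.+1%:R * `|x| ^+ 2) by ring.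
apply: (@le_trans _ _ (\sum_(i < n) `|x| ^+ 2)).
  apply: ler_sum => i _; rewrite -[x 0 i ^+ 2]real_normK ?num_real//.
  by rewrite lerXn2r ?nnegrE//; exact: rV_coord_le_norm.
rewrite sumr_const card_ord -[leLHS]mulr_natl.
have x20 : 0 <= `|x| ^+ 2 by exact: sqr_ge0.
by rewrite [leRHS]mulrA ler_wpM2r// -natrM ler_nat (leq_trans (leqnSn n))// leq_pmull.
Qed.

End norms.

(** * Continuity of convex functions in finite dimension *)

Section convex_continuity.
Variables (R : realType) (n : nat) (W : 'rV[R]_n -> R).
Hypothesis W_convex : convex_function setT W.

(* [a + t e_i + z] is a convex combination of [a + e_i + z] and [a - e_i + z], so
   the bound on a box follows from bounds on boxes of one dimension less. *)
Lemma convex_box_bound (s : seq 'I_n) (a : 'rV[R]_n) :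
  exists M : R, forall t : 'I_n -> R, (forall i, `|t i| <= 1) ->
    W (a + \sum_(i <- s) t i *: delta_mx 0 i) <= M.
Proof.
elim: s a => [|i s IHs] a.
  by exists (W a) => t _; rewrite big_nil addr0.
have [M1 M1P] := IHs (a + delta_mx 0 i).
have [M2 M2P] := IHs (a - delta_mx 0 i).
exists (Num.max M1 M2) => t t1; rewrite big_cons.
set z := \sum_(_ <- _) _.
have := t1 i; rewrite ler_norml => /andP[tge tle].
pose u : R := (1 + t i) / 2.
have -> : a + (t i *: delta_mx 0 i + z) =
    u *: (a + delta_mx 0 i + z) + (1 - u) *: (a - delta_mx 0 i + z).
  by apply/rowP => k; rewrite !mxE /u; field.
have u0 : 0 <= u by rewrite /u; lra.
have u1 : u <= 1 by rewrite /u; lra.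
move/convex_functionP: W_convex => /(_ u _ _ u0 u1)/le_trans; apply.
have le1 : W (a + delta_mx 0 i + z) <= Num.max M1 M2.
  by rewrite le_max M1P.
have le2 : W (a - delta_mx 0 i + z) <= Num.max M1 M2.
  by rewrite le_max M2P// orbT.
nra.
Qed.

(** The unit ball of the sup norm is the box spanned by all the coordinates. *)
Lemma convex_ball_bound (a : 'rV[R]_n) :
  exists M : R, forall y, `|y| <= 1 -> W (a + y) <= M.
Proof.
have [M MP] := convex_box_bound (enum 'I_n) a.
exists M => y y1; rewrite [y]row_sum_delta -big_enum /=.
by apply: MP => i; apply: le_trans y1; exact: rV_coord_le_norm.
Qed.

(** An upper bound [M] on the unit ball around [a] gives, by convexity, a Lipschitz estimate at [a]
    with constant [M - W a]. *)
Lemma convex_continuous : continuous W.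
Proof.
move=> a; have [M MP] := convex_ball_bound a.
have aM : W a <= M by rewrite -[a]addr0 MP// normr0.
suff lip y : `|y| < 1 -> `|W a - W (a + y)| <= `|y| * (M - W a).
  apply: (@cvgrPdist_le _ _ _ (nbhs a) _ W (W a)).2 => e e0; near=> x.
  have xa1 : `|x - a| < 1.
    by rewrite distrC; near: x; apply: cvgr_dist_lt.
  (* The [+ 1] keeps the denominator positive when [M = W a]. *)
  have xae : `|x - a| <= e / (M - W a + 1).
    rewrite distrC; near: x; apply: cvgr_dist_le => //.
    by rewrite divr_gt0//; lra.
  have := lip _ xa1; rewrite subrKC => /le_trans; apply.
  have /ler_wpM2r := xae => /(_ (M - W a)); rewrite subr_ge0 => /(_ aM).
  move/le_trans; apply; rewrite mulrAC ler_pdivrMr; last lra.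
  nra.
move=> y1; have [->|y0] := eqVneq y 0; first by rewrite addr0 subrr !normr0 mul0r.
have ny0 : 0 < `|y| by rewrite normr_gt0.
set t := `|y|; pose v := t^-1 *: y.
have v1 : `|v| <= 1 by rewrite normrZ normfV normr_id mulVf// gt_eqF.
have vM := MP _ v1.
have vM' : W (a - v) <= M by apply: MP; rewrite normrN.
have yE : y = t *: v by rewrite scalerA mulfV ?scale1r// gt_eqF.
move/convex_functionP: W_convex => cW.
(* Convexity along [a - v, a, a + y, a + v], where y = t v and |v| = 1. *)
have up := cW t (a + v) a (ltW ny0) (ltW y1).
have tp : 0 < 1 + t by rewrite addr_gt0.
have lo := cW (1 + t)^-1 (a + y) (a - v).
have {up} : W (a + y) <= t * W (a + v) + (1 - t) * W a.
  suff -> : a + y = t *: (a + v) + (1 - t) *: a by [].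
  by rewrite {1}yE; apply/rowP => k; rewrite !mxE; ring.
(* The point [a] divides the segment from [a + y] to [a - v] with weights [1 / (1 + t)] and
   [t / (1 + t)]. *)
have {lo} : W a <= (1 + t)^-1 * W (a + y) + (1 - (1 + t)^-1) * W (a - v).
  have aE : (1 + t)^-1 *: (a + y) + (1 - (1 + t)^-1) *: (a - v) = a.
    rewrite yE; apply/rowP => k; rewrite !mxE; field.
    by rewrite !gt_eqF.
  rewrite -{1}aE; apply: lo; first by rewrite invr_ge0 ltW.
  by rewrite invf_le1// lerDl ltW.
have -> : (1 + t)^-1 * W (a + y) + (1 - (1 + t)^-1) * W (a - v) =
    (W (a + y) + t * W (a - v)) / (1 + t) by field; rewrite ?gt_eqF.
rewrite ler_pdivlMr// => lo up.
have tvM := ler_wpM2l (ltW ny0) vM.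
have tvM' := ler_wpM2l (ltW ny0) vM'.
rewrite -/t in tvM tvM'.
rewrite ler_norml; apply/andP; split; nra.
Unshelve. all: by end_near.
Qed.

End convex_continuity.

(** * The pointwise maximum of the [V k] *)

Section max_fun.
Variables (R : realType) (n K : nat) (hK : (0 < K)%N) (V : 'I_K -> 'rV[R]_n -> R).

Lemma le_max_fun (k : 'I_K) (x : 'rV[R]_n) : V k x <= max_fun hK V x.
Proof. exact: le_bigmax. Qed.

Lemma max_fun_convex :
  (forall k, convex_function setT (V k)) -> convex_function setT (max_fun hK V).
Proof.
move=> cV; apply/convex_functionP => t x y t0 t1.
have kle k : V k (t *: x + (1 - t) *: y) <=
    t * max_fun hK V x + (1 - t) * max_fun hK V y.
  have /convex_functionP/(_ t x y t0 t1)/le_trans := cV k; apply.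
  by rewrite lerD// ler_wpM2l// ?subr_ge0//; exact: le_max_fun.
by apply/bigmax_leP; split.
Qed.

Lemma max_fun_positive_definite :
  (forall k, positive_definite (V k)) -> positive_definite (max_fun hK V).
Proof.
move=> pV; split.
  rewrite /max_fun (pV _).1; apply: big1_idem => [|k _]; first exact: maxxx.
  by rewrite (pV _).1.
move=> x /(pV (Ordinal hK)).2/lt_le_trans; apply; exact: le_max_fun.
Qed.

(** Whichever [k] dominates a given pair, [V k] lies below the maximum; finitely many strict bounds
    then give a strict bound on their maximum. *)
Lemma max_fun_decrease (m : nat) (f : 'I_m -> 'rV[R]_n -> 'rV[R]_n) :
  (forall (i : 'I_m) (j : 'I_K), exists k : 'I_K,
     forall x : 'rV[R]_n, x <> 0 -> V j (f i x) < V k x) ->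
  forall i x, x <> 0 -> max_fun hK V (f i x) < max_fun hK V x.
Proof.
move=> decr i x x0.
have jlt j : V j (f i x) < max_fun hK V x.
  by have [k /(_ _ x0)/lt_le_trans] := decr i j; apply; exact: le_max_fun.
by apply/bigmax_ltP; split.
Qed.

End max_fun.

(** * Compactness and coercivity *)

Section compactness.
Variables (R : realType) (n : nat).

Lemma closed_ball_set_compact (r : R) (A : set 'rV[R]_n) :
  closed A -> compact [set x : 'rV[R]_n | `|x| <= r /\ A x].
Proof.
move=> cA; apply: bounded_closed_compact.
  exists r; split; first exact: num_real.
  by move=> M rM x /= [xr _]; exact: le_trans xr (ltW rM).
apply: (@closedI _ [set x : 'rV[R]_n | `|x| <= r]) => //.
apply: (@closed_comp _ _ (fun x : 'rV[R]_n => `|x|) [set t : R | t <= r]).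
  by move=> x _; exact: norm_continuous.
exact: closed_le.
Qed.

(* A convex function vanishing at 0 grows at least linearly along rays, at the
   rate set by its minimum on the sphere of radius [r]. *)
Lemma convex_coercive (W : 'rV[R]_n -> R) (r : R) :
  convex_function setT W -> positive_definite W -> 0 < r ->
  exists2 mu : R, 0 < mu & forall x, r <= `|x| -> mu * `|x| <= r * W x.
Proof.
move=> cW [W0 Wpos] r0.
pose S := [set x : 'rV[R]_n | `|x| <= r /\ r <= `|x|].
have cS : compact S.
  apply: (@closed_ball_set_compact r [set x | r <= `|x|]).
  apply: (@closed_comp _ _ (fun x : 'rV[R]_n => `|x|) [set t : R | r <= t]).
    by move=> x _; exact: norm_continuous.
  exact: closed_ge.
have inS x : r <= `|x| -> S ((r / `|x|) *: x).
  move=> rx; have x0 : 0 < `|x| by exact: lt_le_trans rx.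
  rewrite /S /= normrZ normrM normfV normr_id (gtr0_norm r0) mulfVK ?gt_eqF//.
(* If the sphere is empty (dimension 0), no [x] has norm at least [r] and any rate works. *)
have [S0|S0] := pselect (S !=set0); last first.
  by exists 1 => // x /inS Sx; exfalso; apply: S0; exists ((r / `|x|) *: x).
have cWS : {within S, continuous W}.
  by apply: continuous_subspaceT; exact: convex_continuous.
have [c /set_mem[_ rc] cmin] := EVT_min_rV S0 cS cWS.
exists (W c) => [|x rx].
  by apply: Wpos => c0; move: rc; rewrite c0 normr0 leNgt r0.
have x0 : 0 < `|x| by exact: lt_le_trans rx.
have t0 : 0 <= r / `|x| by rewrite divr_ge0// ltW.
have t1 : r / `|x| <= 1 by rewrite ler_pdivrMr// mul1r.
have /convex_functionP/(_ (r / `|x|) x 0 t0 t1) := cW.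
rewrite scaler0 addr0 W0 mulr0 addr0 => /(le_trans (cmin _ (mem_set (inS _ rx)))).
by rewrite mulrAC ler_pdivlMr.
Qed.

End compactness.

(** * Lyapunov argument for the switched system *)

Section lyapunov.
Variables (R : realType) (n m : nat) (f : 'I_m -> 'rV[R]_n -> 'rV[R]_n).
Variable W : 'rV[R]_n -> R.
Hypothesis f_cont : forall i, continuous (f i).
Hypothesis f0 : forall i, f i 0 = 0.
Hypothesis W_convex : convex_function setT W.
Hypothesis W_lyap : common_lyapunov f W.

Let W0 : W 0 = 0. Proof. by case: W_lyap => -[]. Qed.

Let W_ge0 x : 0 <= W x.
Proof.
have [->|/eqP x0] := eqVneq x 0; first by rewrite W0.
by case: W_lyap => -[_ Wpos] _; exact/ltW/Wpos.
Qed.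

(* The seed 0 is harmless since [W >= 0]; it covers the case [m = 0]. *)
Let G x := \big[Num.max/0]_(i < m) W (f i x).

Let G_continuous : continuous G.
Proof.
rewrite /G => x; elim: (index_enum _) => [|i s IHs].
  under eq_fun do rewrite big_nil.
  exact: cst_continuous.
under eq_fun do rewrite big_cons.
apply: (@continuous_max _ _ (W \o f i)) => //.
by apply: continuous_comp; [exact: f_cont|exact: convex_continuous].
Qed.

Let G_lt x : x <> 0 -> G x < W x.
Proof.
case: W_lyap => -[_ Wpos] Wlt x0; apply/bigmax_ltP.
by split=> [|i _]; [exact: Wpos|exact: Wlt].
Qed.

Lemma trajectory_step (x : nat -> 'rV[R]_n) (k : nat) :
  trajectory f x -> W (x k.+1) <= G (x k).
Proof.
move/(_ k); apply: convex_hull_le => // _ [i _ <-].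
exact: le_bigmax.
Qed.

Lemma trajectory_nonincreasing (x : nat -> 'rV[R]_n) :
  trajectory f x -> nonincreasing_seq (W \o x).
Proof.
move=> xf; apply/nonincreasing_seqP => k /=.
apply: le_trans (trajectory_step k xf) _.
apply/bigmax_leP; split=> [|i _]; first exact: W_ge0.
(* There is no strict decrease at the origin, but it is a common fixed point. *)
have [->|/eqP x0] := eqVneq (x k) 0; first by rewrite f0.
by apply/ltW; case: W_lyap => _; apply.
Qed.

(** By coercivity, [W < mu] forces the norm below [r]; continuity at 0 makes [W] start below [mu],
    and monotonicity keeps it there. *)
Lemma trajectory_stable : lyapunov_stable f.
Proof.
move=> e e0; pose r := e / n.+1%:R.
have r0 : 0 < r by rewrite divr_gt0.
case: W_lyap => Wpd _.
have [mu mu0 muP] := convex_coercive W_convex Wpd r0.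
have /cvgrPdist_lt/(_ _ mu0)/nbhs_ballP[d /= d0 dP] := convex_continuous W_convex (x:=0).
exists (d / 2) => [|x xf xd k]; first by rewrite divr_gt0.
apply: le_trans (enorm_le_norm _) _; rewrite mulrC -ler_pdivlMr// -/r.
rewrite leNgt; apply/negP => rx.
have : mu * r <= r * W (x k).
  by apply: le_trans (muP _ (ltW rx)); rewrite ler_wpM2l// ltW.
rewrite mulrC ler_pM2l// leNgt => /negP; apply.
apply: le_lt_trans (trajectory_nonincreasing xf (leq0n k)) _ => /=.
have : ball (0 : 'rV[R]_n) d (x 0%N).
  rewrite -ball_normE /ball_ /= sub0r normrN.
  apply: le_lt_trans (norm_le_enorm _) (le_lt_trans xd _); lra.
by move/dP; rewrite /= W0 sub0r normrN ger0_norm.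
Qed.

(* Above a positive level [c], a trajectory stays in a compact set away from 0,
   where [W - G] is bounded below, so it loses a fixed amount at each step. *)
Lemma trajectory_level (x : nat -> 'rV[R]_n) (c : R) :
  trajectory f x -> 0 < c -> exists k, W (x k) < c.
Proof.
move=> xf c0; apply: contrapT => /forallNP xc.
have {}xc k : c <= W (x k) by rewrite leNgt; apply/negP.
have [mu mu0 muP] := convex_coercive W_convex W_lyap.1 (@ltr01 R).
(* A point of the trajectory has norm at most 1, or else coercivity gives
   [mu * |x k| <= W (x k) <= W (x 0)]. *)
pose r := Num.max 1 (W (x 0%N) / mu).
pose A := [set y : 'rV[R]_n | `|y| <= r /\ c <= W y].
have xA k : A (x k).
  split; last exact: xc.
  rewrite /r le_max; have [//|/ltW x1 /=] := leP `|x k| 1.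
  rewrite ler_pdivlMr// mulrC; apply: le_trans (muP _ x1) _; rewrite mul1r.
  exact: (trajectory_nonincreasing xf (leq0n k)).
have cA : compact A.
  apply: (@closed_ball_set_compact _ _ r [set y | c <= W y]).
  apply: (@closed_comp _ _ W [set t : R | c <= t]); last exact: closed_ge.
  by move=> y _; exact: convex_continuous.
have cWG : {within A, continuous (fun y => W y - G y)}.
  apply: continuous_subspaceT => y; apply: continuousB; first exact: convex_continuous.
  exact: G_continuous.
have [z /set_mem[_ cz] zmin] := EVT_min_rV (ex_intro _ _ (xA 0%N)) cA cWG.
set d := W z - G z in zmin.
have d0 : 0 < d.
  by rewrite subr_gt0 G_lt// => z0; move: cz; rewrite z0 W0 leNgt c0.
have drop k : W (x k) <= W (x 0%N) - k%:R * d.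
  elim: k => [|k IHk]; first by rewrite mul0r subr0.
  have := trajectory_step k xf; have := zmin _ (mem_set (xA k)).
  rewrite -natr1; lra.
(* After this many steps, the accumulated loss [k * d] exceeds the initial value of [W]. *)
have [k kP] : exists k : nat, W (x 0%N) / d < k%:R.
  by exists (Num.truncn (W (x 0%N) / d)).+1; exact: truncnS_gt.
move: kP; rewrite ltr_pdivrMr// => kP.
have := drop k; have := xc k; lra.
Qed.

(** Once [W] falls below the coercivity threshold [mu] for radius [e], monotonicity keeps all later
    points within that radius. *)
Lemma trajectory_converges (x : nat -> 'rV[R]_n) :
  trajectory f x -> x @ \oo --> (0 : 'rV[R]_n).
Proof.
move=> xf; apply/cvgr0Pnorm_lt => e e0.
have [mu mu0 muP] := convex_coercive W_convex W_lyap.1 e0.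
have [k Wk] := trajectory_level xf mu0.
exists k => // l /= kl; rewrite ltNge; apply/negP => ex.
have : mu * e <= e * W (x l).
  by apply: le_trans (muP _ ex); rewrite ler_wpM2l// ltW.
rewrite mulrC ler_pM2l// leNgt => /negP; apply.
by apply: le_lt_trans Wk; exact: (trajectory_nonincreasing xf kl).
Qed.

Lemma convex_lyapunov_stable : globally_asymptotically_stable f.
Proof. by split; [exact: trajectory_stable|exact: trajectory_converges]. Qed.

End lyapunov.

Unset Implicit Arguments.
Set Strict Implicit.

Theorem proposition5p1 (R : realType) (n m K : nat)
    (f : 'I_m -> 'rV[R]_n -> 'rV[R]_n)
    (f_cont : forall i : 'I_m, continuous (f i))
    (f0 : forall i : 'I_m, f i 0 = 0)
    (hK : (0 < K)%N)
    (V : 'I_K -> 'rV[R]_n -> R)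
    (V_convex : forall j : 'I_K, convex_function setT (V j))
    (V_pos : forall j : 'I_K, positive_definite (V j))
    (V_decr : forall (i : 'I_m) (j : 'I_K), exists k : 'I_K,
      forall x : 'rV[R]_n, x <> 0 -> V j (f i x) < V k x) :
  globally_asymptotically_stable f /\
  (convex_function setT (max_fun hK V) /\ common_lyapunov f (max_fun hK V)).
Proof.
have cW := max_fun_convex hK V_convex.
have lyW : common_lyapunov f (max_fun hK V).
  by split; [exact: max_fun_positive_definite|exact: max_fun_decrease].
by split; [exact: convex_lyapunov_stable lyW|].
Qed.
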